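(* Let $A\in\mathrm{GL}_r(\mathbb{C}(z))$, consider the difference equation $y(z+1)=A(z)y(z)$, and let $\mathbb{C}[z]^r=L\subseteq M\subseteq\mathbb{C}(z)^r$ be the corresponding difference module $M$. Fix $p\in\mathbb{C}$. Let $P_A\subset p+\mathbb{Z}$ be the set of points of $p+\mathbb{Z}$ at which $A(z)$ is not defined, and $Z_A\subset p+\mathbb{Z}$ the set of points of $p+\mathbb{Z}$ at which $A(z)^{-1}$ is not defined. Order $p+\mathbb{Z}$ via $\mathbb{Z}$ (inequalities between a point and a set mean that they hold for all elements of the set). Define matrices $(A^{(n)}(z))_{n\in\mathbb{Z}}$ by $$A^{(0)}(z)=\mathrm{Id},\qquad A^{(n+1)}(z)=A^{(n)}(z)A(z+n)^{-1},\qquad A^{(n-1)}(z)=A^{(n)}(z)A(z+n-1);$$ then $\tau^{-n}L$ is generated over $\mathbb{C}[z]$ by the columns of $A^{(n)}$. 1. Let $n_1,n_2\in\mathbb{Z}$ be such that $p+n_1\le Z_A\cup P_A<p+n_2$. Then $$M|^l_{U_p}=(\tau^{-n_1}L)_p,\qquad M|^r_{U_p}=(\tau^{-n_2}L)_p.$$ In terms of matrices, there exists a basis of $M|^l_{U_p}$ such that the coordinates of a basis of $M|^r_{U_p}$ with respect to it are given by the columns of $(A^{(n_1)})^{-1}A^{(n_2)}$. Since a basis for $M|^l_{U_p}$ is a basis for $\mathbb{C}((z-p))\otimes_{\mathbb{C}[[z-p]]}M_p$, this computes $M|_{U_p^*}$. 2. Additionally, let $n_3\le n_4$ be such that $p+n_3\le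 P_A$ and $Z_A<p+n_4$. Then $M_p$ is generated by the submodules $\{(\tau^{-n}L)_p\}_{n_3\le n\le n_4}$; in the standard basis of $L$, $M_p$ is generated over $\mathbb{C}[[z-p]]$ by the columns of $\{A^{(n)}\}_{n_3\le n\le n_4}$. In this case, $M|^l_{U_p}=(\tau^{-n_1}L)_p$ and $M|^r_{U_p}=(\tau^{-n_2}L)_p$, so in the standard basis $M|^l_{U_p}$ (resp. $M|^r_{U_p}$) is the $\mathbb{C}[[z-p]]$-column span of $A^{(n_1)}$ (resp. $A^{(n_2)}$). 3. In particular, suppose that $n_3,n_4$ above can be chosen with $n_3=n_4$. Then $M_p=(\tau^{-n_3}L)_p$. In terms of matrices, there is a basis of $M_p$ in which $M|^l_{U_p}$ (resp. $M|^r_{U_p}$) is the column span of $(A^{(n_3)})^{-1}A^{(n_1)}$ (resp. $(A^{(n_3)})^{-1}A^{(n_2)}$) over $\mathbb{C}[[z-p]]$.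
   Context: $\Delta=\mathbb{C}[z]\langle\tau,\tau^{-1}\rangle$ with $\tau z=(z-1)\tau$. Given $A\in\mathrm{GL}_r(\mathbb{C}(z))$, make $\mathbb{C}(z)^r$ into a $\Delta$-module by $\tau(y(z))=A(z-1)y(z-1)$ (so $\tau^{-1}(y(z))=A(z)^{-1}y(z+1)$). Put $L=\mathbb{C}[z]^r\subset\mathbb{C}(z)^r$; the difference module corresponding to $A$ is the $\Delta$-submodule $M\subseteq\mathbb{C}(z)^r$ generated by $L$. It is holonomic (finitely generated over $\Delta$ and every element annihilated by a nonzero element of $\Delta$). For a $\mathbb{C}[z]$-module $V$, $V_p=\mathbb{C}[[z-p]]\otimes_{\mathbb{C}[z]}V$; for $\mathbb{C}[z]$-submodules of $\mathbb{C}(z)^r$ these are viewed inside $\mathbb{C}((z-p))^r$. For a holonomic $\Delta$-module $M$, choose any finitely generated $\mathbb{C}[z]$-submodule $L'\subseteq M$ with $M/L'$ a torsion $\mathbb{C}[z]$-module and $n\gg0$; then $M|^l_{U_p}:=(\tau^{n}L')_p$ and $M|^r_{U_p}:=(\tau^{-n}L')_p$, which are free finite rank $\mathbb{C}[[z-p]]$-submodules of $M_p$ independent of choices. The local type $M|_{U_p}$ is $M_p$ together with these two submodules, and $M|_{U_p^*}$ is $\mathbb{C}((z-p))\otimes_{\mathbb{C}[[z-p]]}M_p$ together with the images of these two submodules. *)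

(* Defs.v *)
From HB Require Import structures.
From mathcomp Require Import all_boot all_order all_algebra.
From mathcomp Require Import boolp classical_sets functions reals complex.

Set Implicit Arguments.
Unset Strict Implicit.
Unset Printing Implicit Defensive.

Import Order.TTheory GRing.Theory Num.Theory.
Local Open Scope ring_scope.

(** * Formal power series

    [fps F] is F[[t]], and F((t)) is [{fraction fps F}].  At a point p the
    variable t stands for the local coordinate z - p. *)

Record fps (F : Type) := FPS { fcoef :> nat -> F }.

HB.instance Definition _ (F : Type) := gen_eqMixin (fps F).
HB.instance Definition _ (F : Type) := gen_choiceMixin (fps F).

Section FormalPowerSeries.
Variable F : fieldType.
Implicit Types f g h : fps F.

Lemma fpsP f g : f =1 g -> f = g.
Proof. by case: f g => [f] [g] /= /funext ->. Qed.

Definition fps_zero : fps F := FPS (fun=> 0).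
Definition fps_const (c : F) : fps F := FPS (fun n => c *+ (n == 0)%N).
Definition fps_opp f : fps F := FPS (fun n => - f n).
Definition fps_add f g : fps F := FPS (fun n => f n + g n).
Definition fps_mul f g : fps F :=
  FPS (fun n => \sum_(i < n.+1) f i * g (n - i)%N).

Fact fps_addA : associative fps_add.
Proof. by move=> f g h; apply: fpsP => n /=; rewrite addrA. Qed.
Fact fps_addC : commutative fps_add.
Proof. by move=> f g; apply: fpsP => n /=; rewrite addrC. Qed.
Fact fps_add0 : left_id fps_zero fps_add.
Proof. by move=> f; apply: fpsP => n /=; rewrite add0r. Qed.
Fact fps_addN : left_inverse fps_zero fps_opp fps_add.
Proof. by move=> f; apply: fpsP => n /=; rewrite addNr. Qed.

HB.instance Definition _ :=
  GRing.isZmodule.Build (fps F) fps_addA fps_addC fps_add0 fps_addN.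

Definition fps_trunc (m : nat) f : {poly F} := \poly_(i < m) f i.

Lemma coef_trunc m f n : (n < m)%N -> (fps_trunc m f)`_n = f n.
Proof. by move=> nm; rewrite coef_poly nm. Qed.

Lemma fps_mulE m f g n : (n < m)%N ->
  fps_mul f g n = (fps_trunc m f * fps_trunc m g)`_n.
Proof.
move=> nm; rewrite coefM /=; apply: eq_bigr => i _.
by rewrite !coef_trunc // (leq_ltn_trans _ nm) // ?leq_subr // -ltnS.
Qed.

Fact fps_mulA : associative fps_mul.
Proof.
move=> f g h; apply: fpsP => n.
have -> : fps_mul f (fps_mul g h) n =
    (fps_trunc n.+1 f * (fps_trunc n.+1 g * fps_trunc n.+1 h))`_n.
  rewrite coefM; apply: eq_bigr => i _.
  congr (_ * _); first by rewrite coef_trunc.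
  by apply: fps_mulE; rewrite ltnS leq_subr.
rewrite mulrA coefM; apply: eq_bigr => i _; congr (_ * _).
  by apply/esym/fps_mulE.
by rewrite coef_trunc // ltnS leq_subr.
Qed.
Fact fps_mulC : commutative fps_mul.
Proof.
by move=> f g; apply: fpsP => n; rewrite !(@fps_mulE n.+1) // mulrC.
Qed.
Fact fps_mul1 : left_id (fps_const 1) fps_mul.
Proof.
move=> f; apply: fpsP => n /=; rewrite big_ord_recl /= mul1r subn0.
by rewrite big1 ?addr0 // => i _; rewrite mul0r.
Qed.
Fact fps_mulDl : left_distributive fps_mul fps_add.
Proof.
move=> f g h; apply: fpsP => n /=; rewrite -big_split /=.
by apply: eq_bigr => i _; rewrite mulrDl.
Qed.
Fact fps_1neq0 : fps_const 1 != 0.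
Proof.
apply/eqP => /(congr1 (fun f : fps F => f 0%N)) /= /eqP.
by rewrite oner_eq0.
Qed.

HB.instance Definition _ := GRing.Zmodule_isComNzRing.Build (fps F)
  fps_mulA fps_mulC fps_mul1 fps_mulDl fps_1neq0.

Lemma fcoef0 n : (0 : fps F) n = 0. Proof. by []. Qed.
Lemma fcoef1 n : (1 : fps F) n = (n == 0)%:R. Proof. by []. Qed.
Lemma fcoefN f n : (- f) n = - f n. Proof. by []. Qed.
Lemma fcoefD f g n : (f + g) n = f n + g n. Proof. by []. Qed.
Lemma fcoefM f g n : (f * g) n = \sum_(i < n.+1) f i * g (n - i)%N.
Proof. by []. Qed.
Lemma fcoef_sum I (s : seq I) (P : pred I) (G : I -> fps F) n :
  (\sum_(i <- s | P i) G i) n = \sum_(i <- s | P i) G i n.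
Proof. by apply: (big_morph (fun f : fps F => f n)). Qed.

Lemma fcoefCM c f n : (fps_const c * f) n = c * f n.
Proof.
rewrite fcoefM big_ord_recl /= subn0 mulr1n big1 ?addr0 // => i _.
by rewrite mulr0n mul0r.
Qed.

Lemma fcoefX_small g k n : g 0%N = 0 -> (n < k)%N -> (g ^+ k) n = 0.
Proof.
move=> g0; elim: k n => // k IHk n; rewrite ltnS => nk.
rewrite exprS fcoefM big1 // => -[[|i] /= lti] _; first by rewrite g0 mul0r.
rewrite IHk ?mulr0 //; case: n nk lti => // n nk _.
by rewrite subSS (leq_ltn_trans (leq_subr _ _)).
Qed.

(* 1 / f is the geometric series of 1 - f / f(0), divided by f(0). *)
Definition fps_geom f : fps F := fps_const (f 0%N)^-1 *
  FPS (fun n => (\sum_(k < n.+1) (1 - fps_const (f 0%N)^-1 * f) ^+ k) n).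
Definition fps_unit : pred (fps F) := fun f => f 0%N != 0.
Definition fps_inv f : fps F := if fps_unit f then fps_geom f else f.

Fact fps_mulV : {in fps_unit, left_inverse 1 fps_inv *%R}.
Proof.
move=> f f0; rewrite /fps_inv -[fps_unit f]/(f \in fps_unit) f0.
set c := (f 0%N)^-1; set g := 1 - fps_const c * f.
have g0 : g 0%N = 0.
  by rewrite fcoefD fcoefN fcoefCM fcoef1 mulVf // subrr.
rewrite /fps_geom -/c -/g mulrAC.
have -> : fps_const c * f = 1 - g by rewrite /g opprB addrC subrK.
apply: fpsP => n.
have -> : ((1 - g) * FPS (fun m => (\sum_(k < m.+1) g ^+ k) m)) n =
    ((1 - g) * \sum_(k < n.+1) g ^+ k) n.
  rewrite !fcoefM; apply: eq_bigr => i _; congr (_ * _) => /=.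
  rewrite -!(big_mkord xpredT (fun k => g ^+ k)).
  rewrite [in RHS](@big_cat_nat _ _ _ (n - i).+1) //= ?ltnS ?leq_subr //.
  rewrite [X in _ = _ + X]fcoef_sum [X in _ = _ + X]big_nat_cond.
  rewrite [X in _ = _ + X]big1 ?addr0 // => k /andP[/andP[lek _] _].
  by rewrite fcoefX_small.
have -> : (1 - g) * (\sum_(k < n.+1) g ^+ k) = 1 - g ^+ n.+1.
  by rewrite -[LHS]opprK -mulNr opprB -subrX1 opprB.
by rewrite fcoefD fcoefN fcoefX_small // subr0.
Qed.
Fact fps_unitPl f g : g * f = 1 -> fps_unit f.
Proof.
move=> /(congr1 (fun h : fps F => h 0%N)); rewrite fcoefM fcoef1 big_ord1 /=.
by move=> gf; apply/eqP => f0; move/eqP: gf; rewrite f0 mulr0 eq_sym oner_eq0.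
Qed.
Fact fps_inv_out : {in [predC fps_unit], fps_inv =1 id}.
Proof.
move=> f; rewrite inE /= /fps_inv -[f \in _]/(fps_unit f).
by move=> /negbTE ->.
Qed.

HB.instance Definition _ := GRing.ComNzRing_hasMulInverse.Build (fps F)
  fps_mulV fps_unitPl fps_inv_out.

Lemma fps_neq0 f : f != 0 ->
  exists n, f n != 0 /\ forall m, (m < n)%N -> f m = 0.
Proof.
move=> f0; have ex : exists n, f n != 0.
  apply: contrapT => nex; move/eqP: f0; apply; apply: fpsP => n.
  by apply: contrapT => fn; apply: nex; exists n; apply/eqP.
exists (ex_minn ex); case: ex_minnP => n fn minn; split=> // m mn.
by apply/eqP; apply: contraTT mn => /minn; rewrite -leqNgt.
Qed.

Fact fps_integral f g : f * g = 0 -> (f == 0) || (g == 0).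
Proof.
move=> fg; apply/negPn/negP; rewrite negb_or => /andP[].
move=> /fps_neq0[i [fi mini]] /fps_neq0[j [gj minj]].
have: (f * g) (i + j)%N = 0 by rewrite fg.
have ilt : (i < (i + j).+1)%N by rewrite ltnS leq_addr.
rewrite fcoefM (bigD1 (Ordinal ilt)) //= addKn big1 ?addr0.
  by move/eqP; rewrite mulf_eq0 (negbTE fi) (negbTE gj).
move=> k; rewrite -val_eqE /= => ki.
have [lt|gt|eq] := ltngtP k i; last by rewrite eq eqxx in ki.
  by rewrite mini ?mul0r.
have kle : (k <= i + j)%N by rewrite -ltnS.
by rewrite minj ?mulr0 // ltn_subLR // ltn_add2r.
Qed.

HB.instance Definition _ :=
  GRing.ComUnitRing_isIntegral.Build (fps F) fps_integral.

End FormalPowerSeries.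

(** * Fields of fractions *)

Notation frac_incl := (@FracField.tofrac _).
Notation "x %:F" := (FracField.tofrac x) : ring_scope.

(* The extension to the fraction fields of a ring map f : R -> S; it is
   meaningful only for injective f, see [frac_mapE]. *)
HB.lock Definition frac_map (R S : idomainType) (f : R -> S) (x : {fraction R}) :
    {fraction S} :=
  (f (\n_(repr x)))%:F / (f (\d_(repr x)))%:F.

Section FracMap.
Variables (R S : idomainType) (f : {rmorphism R -> S}).
Hypothesis f_inj : injective f.

Lemma fraction_repr (x : {fraction R}) :
  x = (\n_(repr x))%:F / (\d_(repr x))%:F.
Proof.
have dx := denom_ratioP (repr x).
apply: (canRL (mulfK _)); first by rewrite tofrac_eq0.
rewrite -[in LHS](@reprK _ (FracField.type R) x) !piE; apply/eqP.
rewrite piE FracField.equivfE /FracField.mulf.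
rewrite !numden_Ratio ?mulf_neq0 ?oner_eq0 //.
by rewrite reprK !mulr1 mulrC.
Qed.

Lemma frac_mapE a b : b != 0 -> frac_map f (a%:F / b%:F) = (f a)%:F / (f b)%:F.
Proof.
move=> b0; rewrite frac_map.unlock; set x := a%:F / b%:F.
have dx := denom_ratioP (repr x).
have fneq0 c : c != 0 -> (f c)%:F != 0.
  by rewrite tofrac_eq0 -(rmorph0 f) (inj_eq f_inj).
have /eqP := fraction_repr x.
rewrite {1}/x eqr_div ?tofrac_eq0 // -!tofracM tofrac_eq => /eqP e.
apply/eqP; rewrite eqr_div ?fneq0 // -!tofracM tofrac_eq -!rmorphM.
by rewrite e.
Qed.

Lemma frac_map_zmod_morphism : zmod_morphism (frac_map f).
Proof.
have fneq0 c : c != 0 -> (f c)%:F != 0.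
  by rewrite tofrac_eq0 -(rmorph0 f) (inj_eq f_inj).
move=> x y; rewrite {1}(fraction_repr x) {1}(fraction_repr y).
set a := \n_(repr x); set b := \d_(repr x).
set c := \n_(repr y); set d := \d_(repr y).
have b0 : b != 0 := denom_ratioP _; have d0 : d != 0 := denom_ratioP _.
have -> : a%:F / b%:F - c%:F / d%:F = (a * d - c * b)%:F / (b * d)%:F.
  by rewrite -mulNr addf_div ?tofrac_eq0 // mulNr tofracB !tofracM.
rewrite frac_mapE ?mulf_neq0 // frac_map.unlock -/a -/b -/c -/d.
by rewrite -[in RHS]mulNr addf_div ?fneq0 // mulNr !rmorphB !rmorphM.
Qed.

Lemma frac_map_monoid_morphism : monoid_morphism (frac_map f).
Proof.
split.
  have -> : 1 = (1 : R)%:F / (1 : R)%:F :> {fraction R}.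
    by rewrite tofrac1 divr1.
  by rewrite frac_mapE ?oner_eq0 // !rmorph1 divr1.
move=> x y /=; rewrite {1}(fraction_repr x) {1}(fraction_repr y).
rewrite mulf_div -!tofracM frac_mapE ?mulf_neq0 ?denom_ratioP // frac_map.unlock.
rewrite mulf_div.
by rewrite !rmorphM.
Qed.

End FracMap.

(** * Shifts and expansions of rational functions *)

Section RationalFunctions.
Variable F : fieldType.

(* q(z) |-> q(z + c) *)
Definition poly_shift (c : F) (q : {poly F}) : {poly F} := q \Po ('X + c%:P).

Lemma poly_shift_zmod c : zmod_morphism (poly_shift c).
Proof. by move=> q s; rewrite /poly_shift comp_polyB. Qed.
Lemma poly_shift_monoid c : monoid_morphism (poly_shift c).
Proof.
by split=> [|q s]; rewrite /poly_shift ?comp_polyM // -polyC1 comp_polyC.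
Qed.
HB.instance Definition _ c := GRing.isZmodMorphism.Build {poly F} {poly F}
  (poly_shift c) (poly_shift_zmod c).
HB.instance Definition _ c := GRing.isMonoidMorphism.Build {poly F} {poly F}
  (poly_shift c) (poly_shift_monoid c).

Lemma poly_shiftD c d q : poly_shift c (poly_shift d q) = poly_shift (c + d) q.
Proof.
rewrite /poly_shift -comp_polyA comp_polyD comp_polyX comp_polyC.
by rewrite -addrA -polyCD.
Qed.

Lemma poly_shift0 q : poly_shift 0 q = q.
Proof. by rewrite /poly_shift polyC0 addr0 comp_polyXr. Qed.

Lemma poly_shift_inj c : injective (poly_shift c).
Proof.
apply: (can_inj (g := poly_shift (- c))) => q.
by rewrite poly_shiftD addNr poly_shift0.
Qed.

(* Taylor expansion at p : the coefficient of t^n in q(p + t) *)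
Definition poly_taylor (p : F) (q : {poly F}) : fps F :=
  FPS (fun n => (poly_shift p q)`_n).

Lemma poly_taylor_zmod p : zmod_morphism (poly_taylor p).
Proof. by move=> q s; apply: fpsP => n; rewrite /= rmorphB coefB. Qed.
Lemma poly_taylor_monoid p : monoid_morphism (poly_taylor p).
Proof.
split=> [|q s]; apply: fpsP => n /=; first by rewrite rmorph1 coef1.
by rewrite rmorphM coefM.
Qed.
HB.instance Definition _ p := GRing.isZmodMorphism.Build {poly F} (fps F)
  (poly_taylor p) (poly_taylor_zmod p).
HB.instance Definition _ p := GRing.isMonoidMorphism.Build {poly F} (fps F)
  (poly_taylor p) (poly_taylor_monoid p).

Lemma poly_taylor_inj p : injective (poly_taylor p).
Proof.
move=> q s e; apply: (@poly_shift_inj p); apply/polyP => n.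
exact: (congr1 (fun f : fps F => f n) e).
Qed.

(* f(z) |-> f(z + c) on F(z) *)
Definition shift (c : F) : {fraction {poly F}} -> {fraction {poly F}} :=
  frac_map (poly_shift c).
(* F(z) -> F((z - p)) *)
Definition expand (p : F) : {fraction {poly F}} -> {fraction fps F} :=
  frac_map (poly_taylor p).

HB.instance Definition _ c := GRing.isZmodMorphism.Build _ _ (shift c)
  (frac_map_zmod_morphism (@poly_shift_inj c)).
HB.instance Definition _ c := GRing.isMonoidMorphism.Build _ _ (shift c)
  (frac_map_monoid_morphism (@poly_shift_inj c)).
HB.instance Definition _ p := GRing.isZmodMorphism.Build _ _ (expand p)
  (frac_map_zmod_morphism (@poly_taylor_inj p)).
HB.instance Definition _ p := GRing.isMonoidMorphism.Build _ _ (expand p)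
  (frac_map_monoid_morphism (@poly_taylor_inj p)).

Lemma shift_div c a b : b != 0 ->
  shift c (a%:F / b%:F) = (poly_shift c a)%:F / (poly_shift c b)%:F.
Proof. exact/frac_mapE/poly_shift_inj. Qed.

Lemma expand_div p a b : b != 0 ->
  expand p (a%:F / b%:F) = (poly_taylor p a)%:F / (poly_taylor p b)%:F.
Proof. exact/frac_mapE/poly_taylor_inj. Qed.

Lemma shift_tofrac c q : shift c q%:F = (poly_shift c q)%:F.
Proof.
by rewrite -[q%:F]divr1 -tofrac1 shift_div ?oner_eq0 // rmorph1 tofrac1 divr1.
Qed.

Lemma expand_tofrac p q : expand p q%:F = (poly_taylor p q)%:F.
Proof.
by rewrite -[q%:F]divr1 -tofrac1 expand_div ?oner_eq0 // rmorph1 tofrac1 divr1.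
Qed.

Lemma poly_shift_eq0 c q : (poly_shift c q == 0) = (q == 0).
Proof. by rewrite -[in RHS](inj_eq (@poly_shift_inj c)) rmorph0. Qed.

Lemma shiftD c d x : shift c (shift d x) = shift (c + d) x.
Proof.
rewrite (fraction_repr x); have := denom_ratioP (repr x).
move: (\n__) (\d__) => a b b0.
by rewrite [shift d _]shift_div // !shift_div ?poly_shift_eq0 // !poly_shiftD.
Qed.

Lemma shift0 x : shift 0 x = x.
Proof.
rewrite (fraction_repr x); have := denom_ratioP (repr x).
move: (\n__) (\d__) => a b b0.
by rewrite shift_div // !poly_shift0.
Qed.

Definition defined_at (q : F) (x : {fraction {poly F}}) : Prop :=
  exists a b : {poly F}, b.[q] != 0 /\ x = a%:F / b%:F.

Definition mx_defined_at r (q : F) (A : 'M[{fraction {poly F}}]_r) : Prop :=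
  forall i j, defined_at q (A i j).

End RationalFunctions.

Local Open Scope classical_set_scope.

(** * Submodules of K^r over a ring S acting through iota : S -> K *)

Section Submodules.
Variables (S : pzRingType) (K : fieldType) (iota : S -> K) (r : nat).
Implicit Types V X : set 'cV[K]_r.

Definition is_submodule V : Prop :=
  [/\ V 0, forall u v, V u -> V v -> V (u + v)
    & forall a v, V v -> V (iota a *: v)].

Definition submod_span X : set 'cV[K]_r := smallest is_submodule X.

Definition columns k (B : 'M[K]_(r, k)) : set 'cV[K]_r :=
  range (fun j => col j B).

Definition colspan k (B : 'M[K]_(r, k)) : set 'cV[K]_r := submod_span (columns B).

(* The columns of B form an S-basis of V. *)
Definition is_basis k (B : 'M[K]_(r, k)) V : Prop :=
  V = colspan B /\ forall c : 'cV[S]_k, B *m map_mx iota c = 0 -> c = 0.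

Definition finitely_generated V : Prop :=
  exists k (B : 'M[K]_(r, k)), V = colspan B.

(* A submodule of K^r together with two distinguished subsets (in practice the
   left and right lattices). *)
Record bilattice := Bilattice {
  carrier : set 'cV[K]_r;
  left_part : set 'cV[K]_r;
  right_part : set 'cV[K]_r }.

Definition bilattice_iso (X Y : bilattice) : Prop :=
  exists f : 'cV[K]_r -> 'cV[K]_r,
    [/\ set_bij (carrier X) (carrier Y) f,
        forall u v, carrier X u -> carrier X v -> f (u + v) = f u + f v,
        forall a v, carrier X v -> f (iota a *: v) = iota a *: f v,
        f @` left_part X = left_part Y
      & f @` right_part X = right_part Y].

End Submodules.

(** * Difference modules *)

Section DifferenceModules.
Variables (F : fieldType) (r : nat) (A : 'M[{fraction {poly F}}]_r).
Implicit Types (y : 'cV[{fraction {poly F}}]_r)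
  (V M L : set 'cV[{fraction {poly F}}]_r) (p : F).

Definition tau y := map_mx (shift (-1)) (A *m y).
Definition tau_inv y := invmx A *m map_mx (shift 1) y.

Definition tauz (n : int) y :=
  match n with
  | Posz k => iter k tau y
  | Negz k => iter k.+1 tau_inv y
  end.

(* The defining relation tau z = (z - 1) tau of Delta. *)
Lemma tauX y : tau (('X)%:F *: y) = ('X - 1)%:F *: tau y.
Proof.
rewrite /tau -scalemxAr map_mxZ /= shift_tofrac /poly_shift comp_polyX.
by rewrite polyCN.
Qed.

Lemma tau_invK : A \in unitmx -> cancel tau_inv tau.
Proof.
move=> uA y; rewrite /tau /tau_inv mulmxA mulmxV // mul1mx -map_mx_comp.
by apply/matrixP => i j; rewrite mxE /= shiftD addNr shift0.
Qed.

Lemma tauK : A \in unitmx -> cancel tau tau_inv.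
Proof.
move=> uA y; rewrite /tau /tau_inv -map_mx_comp.
rewrite (_ : map_mx _ _ = A *m y) ?mulKmx //.
by apply/matrixP => i j; rewrite mxE /= shiftD subrr shift0.
Qed.

(* Delta is generated as a ring by C[z], tau and tau^-1. *)
Definition is_Delta_submodule V : Prop :=
  [/\ is_submodule frac_incl V, forall y, V y -> V (tau y)
    & forall y, V y -> V (tau_inv y)].

Definition std_lattice : set 'cV[{fraction {poly F}}]_r :=
  range (fun y : 'cV[{poly F}]_r => map_mx frac_incl y).

Definition diff_module : set 'cV[{fraction {poly F}}]_r :=
  smallest is_Delta_submodule std_lattice.

(* V_p = C[[z - p]] (x) V, viewed inside C((z - p))^r *)
Definition localize p V : set 'cV[{fraction fps F}]_r :=
  submod_span frac_incl (map_mx (expand p) @` V).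

(* C((z - p)) (x) V_p, viewed inside C((z - p))^r *)
Definition generic_fiber p V : set 'cV[{fraction fps F}]_r :=
  submod_span idfun (localize p V).

(* The admissible choices of L' in the definition of M|^l and M|^r. *)
Definition full_sublattice M L : Prop :=
  [/\ finitely_generated frac_incl L, L `<=` M
    & forall y, M y -> exists2 q : {poly F}, q != 0 & L (q%:F *: y)].

(* The common value of (tau^n L')_p (resp. (tau^-n L')_p) for n >> 0, for all
   admissible L'. The default set0 is not a submodule. *)
Definition restr_left p M : set 'cV[{fraction fps F}]_r :=
  xget set0 [set N | forall L, full_sublattice M L ->
    exists n0 : nat, forall n : nat, (n0 <= n)%N ->
      localize p (tauz n%:Z @` L) = N].

Definition restr_right p M : set 'cV[{fraction fps F}]_r :=
  xget set0 [set N | forall L, full_sublattice M L ->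
    exists n0 : nat, forall n : nat, (n0 <= n)%N ->
      localize p (tauz (- n%:Z) @` L) = N].

(* M|_{U_p^*}; M|^l and M|^r embed in C((z - p)) (x) M_p as they are, since
   everything lies in C((z - p))^r. *)
Definition restr_Ustar p M : bilattice {fraction fps F} r :=
  Bilattice (generic_fiber p M) (restr_left p M) (restr_right p M).

(* A^(n) is [Aiter n]; its two recurrences are [AiterS] and [AiterP]. *)
Fixpoint Apos (k : nat) : 'M[{fraction {poly F}}]_r :=
  if k is k'.+1 then Apos k' *m invmx (map_mx (shift k'%:R) A) else 1%:M.

Fixpoint Aneg (k : nat) : 'M[{fraction {poly F}}]_r :=
  if k is k'.+1 then Aneg k' *m map_mx (shift (- k'.+1%:R)) A else 1%:M.

Definition Aiter (n : int) : 'M[{fraction {poly F}}]_r :=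
  match n with Posz k => Apos k | Negz k => Aneg k.+1 end.

Lemma Aiter0 : Aiter 0 = 1%:M. Proof. by []. Qed.

Lemma AiterS n : A \in unitmx ->
  Aiter (n + 1) = Aiter n *m invmx (map_mx (shift n%:~R) A).
Proof.
move=> uA; case: n => [k|k]; first by rewrite -PoszD addn1.
have uS c : map_mx (shift c) A \in unitmx by rewrite map_unitmx.
have -> : Negz k + 1 = - k%:Z by rewrite NegzE -addn1 PoszD opprD subrK.
have -> : Aiter (- k%:Z) = Aneg k by case: k.
have -> : (Negz k)%:~R = - k.+1%:R :> F by rewrite NegzE mulrNz.
rewrite -[Aiter (Negz k)]/(Aneg k *m map_mx (shift (- k.+1%:R)) A).
by rewrite (mulmxK (uS _)).
Qed.

Lemma AiterP n : A \in unitmx ->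
  Aiter (n - 1) = Aiter n *m map_mx (shift (n - 1)%:~R) A.
Proof.
move=> uA; have uS : map_mx (shift (n - 1)%:~R) A \in unitmx.
  by rewrite map_unitmx.
by rewrite -[n in Aiter n *m _](subrK 1) (AiterS _ uA) (mulmxKV uS).
Qed.

End DifferenceModules.

(** * The coset p + Z *)

Section Coset.
Variable F : fieldType.

Definition Zcoset (p : F) : set F := range (fun n : int => p + n%:~R).

(* The order of p + Z induced from Z (for F of characteristic 0) *)
Definition Zle (x y : F) : Prop := exists k : nat, y = x + k%:R.
Definition Zlt (x y : F) : Prop := exists k : nat, y = x + k.+1%:R.

Definition P_set r (p : F) (A : 'M[{fraction {poly F}}]_r) : set F :=
  [set q | Zcoset p q /\ ~ mx_defined_at q A].
Definition Z_set r (p : F) (A : 'M[{fraction {poly F}}]_r) : set F :=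
  [set q | Zcoset p q /\ ~ mx_defined_at q (invmx A)].

End Coset.

(* Main.v *)
Require Import Defs.
From HB Require Import structures.
From mathcomp Require Import all_boot all_order all_algebra.

From mathcomp Require Import zify.
From mathcomp Require Import boolp classical_sets functions reals complex.

Set Implicit Arguments.
Unset Strict Implicit.
Unset Printing Implicit Defensive.

Import Order.TTheory GRing.Theory Num.Theory.
Local Open Scope ring_scope.
Local Open Scope classical_set_scope.

(** Write Lambda_n for (tau^-n L)_p. Since tau^-n y (z) = A^(n)(z) y(z + n) and
    translation by n preserves L, tau^-n L is the column span of A^(n), and
    Lambda_n is the F[[t]]-span of the expansion of A^(n) at p
    ([tauz_std_lattice], [local_latticeE]). Successive lattices are compared
    through A^(n+1) = A^(n) A(z + n)^-1: if A is defined at p + n, then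
    A(z + n) has an expansion with entries in F[[t]], and Lambda_n is contained
    in Lambda_(n+1); if A^-1 is defined at p + n, the reverse inclusion holds
    ([local_lattice_incr], [local_lattice_decr]). Hence Lambda_n is constant
    below all the singular points, and again above them.

    The two stable values are M|^l and M|^r. What must be seen is that they do
    not depend on the lattice L' with which they are computed
    ([restr_stable]). Two admissible lattices L' and L'' are commensurable: some
    nonzero polynomial q satisfies q L' <= L''. Applying tau^n turns q(z) into
    q(z - n), which is a unit at p as soon as p - n is not a root of q, so
    that the localizations of tau^n L' and tau^n L'' agree for all but
    finitely many n.

    The module M is the sum of the tau^-n L over all n, whence M_p is the sum
    of the Lambda_n ([localize_diff_module_sub], [local_lattice_sub]). Below n3
    the Lambda_n increase and above n4 they decrease, so the terms with
    n3 <= n <= n4 already generate ([local_lattice_band]). The matrix statements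
    follow because the expansion of A^(n) is invertible over F((t)): its columns
    are an F[[t]]-basis of Lambda_n, and the quotient (A^(n))^-1 A^(m) expresses
    Lambda_m in that basis. *)

(** * Spans and bases *)

Section Spans.
Variables (S : pzRingType) (K : fieldType) (iota : {rmorphism S -> K}) (r : nat).
Implicit Types V X : set 'cV[K]_r.

Lemma submod_span_submodule X : is_submodule iota (submod_span iota X).
Proof.
split=> [V [[]]//|u v Xu Xv V VX|a v Xv V VX]; case: (VX) => -[_ VD VZ] _.
  by apply: VD; [apply: Xu|apply: Xv].
by apply: VZ; apply: Xv.
Qed.

Lemma sub_submod_span X : X `<=` submod_span iota X.
Proof. exact: sub_gen_smallest. Qed.

Lemma submod_span_sub X V :
  is_submodule iota V -> X `<=` V -> submod_span iota X `<=` V.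
Proof. exact: smallest_sub. Qed.

Lemma submodule_sum V (I : Type) (s : seq I) (v : I -> 'cV[K]_r) :
  is_submodule iota V -> (forall i, V (v i)) -> V (\sum_(i <- s) v i).
Proof. by case=> V0 VD _ Vv; apply: big_ind. Qed.

Lemma colspanE k (B : 'M[K]_(r, k)) :
  colspan iota B = range (fun c : 'cV[S]_k => B *m map_mx iota c).
Proof.
apply/seteqP; split.
  apply: submod_span_sub.
    split=> [|_ _ [c _ <-] [d _ <-]|a _ [c _ <-]].
    - by exists 0 => //; rewrite map_mx0 mulmx0.
    - by exists (c + d) => //; rewrite map_mxD mulmxDr.
    - by exists (a *: c) => //; rewrite map_mxZ scalemxAr.
  move=> _ [j _ <-]; exists (delta_mx j 0) => //.
  by rewrite map_delta_mx -colE.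
move=> _ [c _ <-]; rewrite [X in _ X](_ : _ = \sum_j iota (c j 0) *: col j B).
  have [_ _ spanZ] := submod_span_submodule (columns B).
  apply: submodule_sum (submod_span_submodule _) _ => j.
  by apply: spanZ; apply: sub_submod_span; exists j.
apply/matrixP => i j; rewrite !mxE summxE ord1.
by apply: eq_bigr => l _; rewrite !mxE mulrC.
Qed.

Lemma colspan_sub k l (B : 'M[K]_(r, k)) (C : 'M[S]_(k, l)) :
  colspan iota (B *m map_mx iota C) `<=` colspan iota B.
Proof.
rewrite !colspanE => _ [c _ <-]; exists (C *m c) => //.
by rewrite map_mxM mulmxA.
Qed.

Lemma unitmx_is_basis (B : 'M[K]_r) :
  injective iota -> B \in unitmx -> is_basis iota B (colspan iota B).
Proof.
move=> iota_inj uB; split=> // c Bc.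
have c0 : map_mx iota c = 0 by rewrite -[LHS](mulKmx uB) Bc mulmx0.
apply/matrixP => i j; apply: iota_inj.
by have /matrixP/(_ i j) := c0; rewrite !mxE rmorph0.
Qed.

End Spans.

Lemma colspan_mulmx (S : pzRingType) (K : fieldType) (iota : {rmorphism S -> K})
    r k l (B : 'M[K]_(r, k)) (C : 'M[K]_(k, l)) :
  colspan iota (B *m C) = mulmx B @` colspan iota C.
Proof.
rewrite !colspanE image_comp; congr image.
by apply/funext => c /=; rewrite mulmxA.
Qed.

Lemma colspan_unitmx (K : fieldType) r (B : 'M[K]_r) :
  B \in unitmx -> colspan idfun B = setT.
Proof.
move=> uB; rewrite colspanE; apply/seteqP; split=> // v _.
exists (invmx B *m v) => //.
by rewrite map_mx_id // mulKVmx.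
Qed.

Lemma mulmx_bilattice_iso (K : fieldType) r (B : 'M[K]_r) (X Y : set 'cV[K]_r) :
    B \in unitmx ->
  bilattice_iso idfun (Bilattice setT X Y)
    (Bilattice setT (mulmx B @` X) (mulmx B @` Y)).
Proof.
move=> uB; exists (mulmx B); split=> //= [|u v _ _|a v _].
- split=> [//|u v _ _ /(congr1 (mulmx (invmx B)))|v _]; first by rewrite !mulKmx.
  by exists (invmx B *m v); rewrite ?mulKVmx.
- exact: mulmxDr.
- by rewrite scalemxAr.
Qed.

Lemma map_columns (K K' : fieldType) (f : K -> K') r k (B : 'M[K]_(r, k)) :
  map_mx f @` columns B = columns (map_mx f B).
Proof.
by rewrite image_comp; congr image; apply/funext => j /=; rewrite map_col.
Qed.

(** Spans are compatible with maps that are linear only up to a change of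
    scalars [phi]: the expansion at p (from polynomials to power series), and
    tau and its inverse (which translate the scalars), are of this kind. *)
Lemma semilinear_span (S S' : pzRingType) (K K' : fieldType)
    (iota : {rmorphism S -> K}) (iota' : {rmorphism S' -> K'}) (phi : S -> S')
    r r' (f : 'cV[K]_r -> 'cV[K']_r') (X : set 'cV[K]_r) :
    {morph f : u v / u + v} ->
    (forall a v, f (iota a *: v) = iota' (phi a) *: f v) ->
  f @` submod_span iota X `<=` submod_span iota' (f @` X).
Proof.
move=> fD fZ; have [span0 spanD spanZ] := submod_span_submodule iota' (f @` X).
apply/image_subP; apply: submod_span_sub => [|v Xv].
  split=> [|u v Xu Xv|a v Xv] /=; rewrite ?fD ?fZ; [|exact: spanD|exact: spanZ].
  by rewrite -(addrK (f 0) (f 0)) -fD addr0 subrr.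
by apply: sub_submod_span; exists v.
Qed.

(** * Denominators *)

Section Denominators.
Variable R : idomainType.

(** The product of the individual scalars works: it is nonzero over a domain,
    and it is a multiple of each of them. *)
Lemma common_multiple (I : finType) (P : I -> R -> Prop) :
    (forall i, exists2 q, q != 0 & P i q) ->
    (forall i q s, P i q -> P i (s * q)) ->
  exists2 q, q != 0 & forall i, P i q.
Proof.
move=> exq PM; have ex i : exists q, q != 0 /\ P i q.
  by have [q] := exq i; exists q.
have [q qP] := choice ex; exists (\prod_i q i).
  by apply/prodf_neq0 => i _; case: (qP i).
by move=> i; rewrite (bigD1 i) //= mulrC; apply: PM; case: (qP i).
Qed.

Lemma clear_denominators m k (B : 'M[{fraction R}]_(m, k)) :
  exists2 q : R, q != 0 & exists C : 'M[R]_(m, k), q%:F *: B = map_mx frac_incl C.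
Proof.
have [|ij q s [a qa]|q q0 qB] := @common_multiple ('I_m * 'I_k)%type
    (fun ij q => exists a : R, q%:F * B ij.1 ij.2 = a%:F).
- move=> [i j] /=; exists \d_(repr (B i j)); first exact: denom_ratioP.
  exists \n_(repr (B i j)); rewrite {2}[B i j]fraction_repr.
  by rewrite mulrC divfK // tofrac_eq0 denom_ratioP.
- by exists (s * a); rewrite !tofracM -mulrA qa.
have [c cP] := choice qB; exists q => //; exists (\matrix_(i, j) c (i, j)).
by apply/matrixP => i j; rewrite !mxE -cP.
Qed.

(** Finite generation enters here: a common multiple of the scalars found for
    the columns serves for all their combinations. *)
Lemma torsion_colspan r k (B : 'M[{fraction R}]_(r, k)) V :
    is_submodule frac_incl V ->
    (forall j, exists2 q : R, q != 0 & V (q%:F *: col j B)) ->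
  exists2 q : R, q != 0 & forall y, colspan frac_incl B y -> V (q%:F *: y).
Proof.
move=> [V0 VD VZ] tors.
have [|q q0 qV] := common_multiple tors.
  by move=> j q s Vq; rewrite tofracM -scalerA; apply: VZ.
exists q => //; apply: submod_span_sub; last by move=> _ [j _ <-].
split=> /= [|u v Vu Vv|a v Vv]; first by rewrite scaler0.
  by rewrite scalerDr; apply: VD.
by rewrite scalerA mulrC -scalerA; apply: VZ.
Qed.

(** The columns of [B] span because they generate those of the invertible
    matrix [E], and a relation between them over the fraction field becomes one
    over the ring after clearing denominators. *)
Lemma frac_basis_generic r (E : 'M[{fraction R}]_r) k (B : 'M_(r, k)) :
    E \in unitmx -> is_basis frac_incl B (colspan frac_incl E) ->
  is_basis idfun B setT.
Proof.
move=> uE [EB freeB]; split; last first.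
  move=> c; rewrite map_mx_id // => Bc.
  have [q q0 [d cd]] := clear_denominators c.
  suff d0 : d = 0.
    have /eqP := cd; rewrite d0 map_mx0 scaler_eq0 tofrac_eq0 (negPf q0) /=.
    by move/eqP.
  by apply: freeB; rewrite -cd -scalemxAr Bc scaler0.
apply/esym/seteqP; split=> // v _.
have : colspan idfun E v by rewrite colspan_unitmx.
apply: submod_span_sub; first exact: submod_span_submodule.
move=> w Ew; have : colspan frac_incl B w by rewrite -EB; apply: sub_submod_span.
rewrite !colspanE => -[c _ <-]; exists (map_mx frac_incl c) => //.
by rewrite map_mx_id.
Qed.

End Denominators.

(** * The lattices of the iterates of tau *)

Section Localization.
Variables (F : fieldType) (r : nat) (p : F).

Lemma localize_span (X : set 'cV[{fraction {poly F}}]_r) :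
  localize p (submod_span frac_incl X) =
    submod_span frac_incl (map_mx (expand p) @` X).
Proof.
apply/seteqP; split; apply: submod_span_sub.
- exact: submod_span_submodule.
- apply: (semilinear_span (phi := poly_taylor p)) => [u v|a v].
    exact: map_mxD.
  by rewrite map_mxZ /= expand_tofrac.
- exact: submod_span_submodule.
- move=> _ [v Xv <-]; apply: sub_submod_span.
  by exists v => //; apply: sub_submod_span.
Qed.

Lemma localize_colspan k (B : 'M_(r, k)) :
  localize p (colspan frac_incl B) = colspan frac_incl (map_mx (expand p) B).
Proof. by rewrite localize_span map_columns. Qed.

Lemma localizeS (V W : set 'cV[{fraction {poly F}}]_r) :
  V `<=` W -> localize p V `<=` localize p W.
Proof.
move=> VW; apply: submod_span_sub; first exact: submod_span_submodule.
by move=> _ [v Vv <-]; apply: sub_submod_span; exists v => //; apply: VW.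
Qed.

Lemma std_latticeE : @std_lattice F r = colspan frac_incl 1%:M.
Proof.
by rewrite colspanE; congr image; apply/funext => y; rewrite mul1mx.
Qed.

Lemma std_lattice_torsion (y : 'cV[{fraction {poly F}}]_r) :
  exists2 q : {poly F}, q != 0 & @std_lattice F r (q%:F *: y).
Proof.
by have [q q0 [c qy]] := clear_denominators y; exists q => //; exists c.
Qed.

End Localization.

Section Iterates.
Variables (F : fieldType) (r : nat) (A : 'M[{fraction {poly F}}]_r).
Hypothesis uA : A \in unitmx.

Lemma shift_mx_comp c d k (y : 'M[{fraction {poly F}}]_(r, k)) :
  map_mx (shift c) (map_mx (shift d) y) = map_mx (shift (c + d)) y.
Proof. by apply/matrixP => i j; rewrite !mxE shiftD. Qed.

Lemma shift_mx0 k (y : 'M[{fraction {poly F}}]_(r, k)) :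
  map_mx (shift 0) y = y.
Proof. by apply/matrixP => i j; rewrite !mxE shift0. Qed.

Lemma tauzE n (y : 'cV_r) :
  tauz A (- n) y = Aiter A n *m map_mx (shift n%:~R) y.
Proof.
have posE k (v : 'cV_r) : iter k (tau_inv A) v = Apos A k *m map_mx (shift k%:R) v.
  elim: k v => [|k IHk] v; first by rewrite /= mul1mx shift_mx0.
  rewrite iterSr IHk /= /tau_inv map_mxM map_invmx shift_mx_comp.
  by rewrite mulmxA natr1.
have negE k (v : 'cV_r) : iter k (tau A) v = Aneg A k *m map_mx (shift (- k%:R)) v.
  elim: k v => [|k IHk] v; first by rewrite /= mul1mx oppr0 shift_mx0.
  rewrite iterSr IHk /= /tau shift_mx_comp map_mxM mulmxA.
  by rewrite -opprD natr1.
case: n => [[|k]|k].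
- exact (posE 0%N y).
- exact (posE k.+1 y).
- have -> : (Negz k)%:~R = - k.+1%:R :> F by rewrite NegzE mulrNz.
  exact: (negE k.+1 y).
Qed.

Lemma Aiter_unitmx n : Aiter A n \in unitmx.
Proof.
have uS c : map_mx (shift c) A \in unitmx by rewrite map_unitmx.
have posU k : Apos A k \in unitmx.
  elim: k => [|k IHk]; first exact: unitmx1.
  by rewrite /= unitmx_mul IHk unitmx_inv uS.
have negU k : Aneg A k \in unitmx.
  elim: k => [|k IHk]; first exact: unitmx1.
  by rewrite /= unitmx_mul IHk uS.
by case: n => [k|k]; [exact: posU|exact: (negU k.+1)].
Qed.

Lemma tauz_std_lattice n :
  tauz A (- n) @` @std_lattice F r = colspan frac_incl (Aiter A n).
Proof.
rewrite -[Aiter A n]mulmx1 colspan_mulmx -std_latticeE; apply/seteqP; split.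
  move=> _ [_ [y _ <-] <-]; rewrite tauzE.
  exists (map_mx (shift n%:~R) (map_mx frac_incl y)) => //.
  exists (map_mx (poly_shift n%:~R) y) => //.
  by apply/matrixP => i j; rewrite !mxE shift_tofrac.
move=> _ [_ [y _ <-] <-].
exists (map_mx frac_incl (map_mx (poly_shift (- n%:~R)) y)); first by eexists.
rewrite tauzE; congr (_ *m _); apply/matrixP => i j.
by rewrite !mxE shift_tofrac poly_shiftD subrr poly_shift0.
Qed.

Lemma localize_tauz p n :
  localize p (tauz A (- n) @` @std_lattice F r) =
    colspan frac_incl (map_mx (expand p) (Aiter A n)).
Proof. by rewrite tauz_std_lattice localize_colspan. Qed.

Lemma tau_tauz n y : tau A (tauz A n y) = tauz A (n + 1) y.
Proof.
case: n => k; first by rewrite -PoszD addn1.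
have -> : Negz k + 1 = - k%:Z by rewrite NegzE -addn1 PoszD opprD subrK.
by rewrite [tauz A (Negz k) y]iterS tau_invK //; case: k.
Qed.

Lemma tau_inv_tauz n y : tau_inv A (tauz A n y) = tauz A (n - 1) y.
Proof. by rewrite -{1}(subrK 1 n) -tau_tauz tauK. Qed.

(** The sum of all tau^-n L is stable under tau and its inverse, which merely
    permute the summands; therefore it contains the module generated by L. *)
Lemma diff_module_sub_span :
  diff_module A `<=` submod_span frac_incl
    (\bigcup_(n in [set: int]) (tauz A (- n) @` @std_lattice F r)).
Proof.
set X := \bigcup_(n in _) _.
have tauX : tau A @` X `<=` X.
  move=> _ [_ [n _ [y Ly <-]] <-]; exists (n - 1) => //.
  by exists y => //; rewrite tau_tauz opprB addrC.
have tau_invX : tau_inv A @` X `<=` X.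
  move=> _ [_ [n _ [y Ly <-]] <-]; exists (n + 1) => //.
  by exists y => //; rewrite tau_inv_tauz opprD.
have stable (f : 'cV_r -> 'cV_r) c : {morph f : u v / u + v} ->
    (forall a v, f (a *: v) = shift c a *: f v) -> f @` X `<=` X ->
    forall y, submod_span frac_incl X y -> submod_span frac_incl X (f y).
  move=> fD fZ fX y Xy.
  apply: (submod_span_sub (submod_span_submodule frac_incl X)
    (X := f @` X)).
    by move=> u /fX; apply: sub_submod_span.
  have fspan : f @` submod_span frac_incl X `<=` submod_span frac_incl (f @` X).
    apply: (semilinear_span (phi := poly_shift c) fD) => a v.
    by rewrite fZ /= shift_tofrac.
  by apply: fspan; exists y.
apply: smallest_sub; last first.
  by move=> y Ly; apply: sub_submod_span; exists 0 => //; exists y.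
split; first exact: submod_span_submodule.
- apply: (stable _ (-1)) => // [u v|a v]; rewrite /tau.
    by rewrite mulmxDr map_mxD.
  by rewrite -scalemxAr map_mxZ.
- apply: (stable _ 1) => // [u v|a v]; rewrite /tau_inv.
    by rewrite map_mxD mulmxDr.
  by rewrite map_mxZ scalemxAr.
Qed.

Lemma std_lattice_sub : @std_lattice F r `<=` diff_module A.
Proof. exact: sub_gen_smallest. Qed.

End Iterates.

(** * Regularity at a point *)

Section Regularity.
Variables (F : fieldType) (p : F).

Lemma poly_taylor_unit (q : {poly F}) :
  (poly_taylor p q \is a GRing.unit) = (q.[p] != 0).
Proof.
rewrite -[LHS]/((poly_shift p q)`_0 != 0) -horner_coef0 /poly_shift.
by rewrite horner_comp !hornerE.
Qed.

Lemma horner_shift (c : F) (q : {poly F}) : (poly_shift c q).[p] = q.[p + c].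
Proof. by rewrite /poly_shift horner_comp !hornerE. Qed.

(** If x = a / b with b nonzero at p + c, the Taylor series of b(z + c) at p has
    nonzero constant term and can be inverted among power series. *)
Lemma defined_at_expand c x : defined_at (p + c) x ->
  exists f : fps F, expand p (shift c x) = f%:F.
Proof.
move=> [a [b [bpc ->]]].
have b0 : b != 0 by apply: contraNneq bpc => ->; rewrite horner0.
have ub : poly_taylor p (poly_shift c b) \is a GRing.unit.
  by rewrite poly_taylor_unit horner_shift.
rewrite shift_div // expand_div ?poly_shift_eq0 //.
exists (poly_taylor p (poly_shift c a) / poly_taylor p (poly_shift c b)).
by rewrite tofracM [(_^-1)%:F]rmorphV.
Qed.

Lemma mx_defined_at_expand r c (B : 'M_r) : mx_defined_at (p + c) B ->
  exists C : 'M[fps F]_r,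
    map_mx (expand p) (map_mx (shift c) B) = map_mx frac_incl C.
Proof.
move=> defB; have ex (ij : 'I_r * 'I_r) : exists f : fps F,
    expand p (shift c (B ij.1 ij.2)) = f%:F by exact: defined_at_expand.
have [f fP] := choice ex; exists (\matrix_(i, j) f (i, j)).
by apply/matrixP => i j; rewrite !mxE -fP.
Qed.

(** Induction on the degree: a root f(n1) of q splits off a linear factor, which
    vanishes at no other f(n) because f is injective. *)
Lemma eventually_not_root (f : nat -> F) (q : {poly F}) :
  injective f -> q != 0 -> exists n0, forall n, (n0 <= n)%N -> q.[f n] != 0.
Proof.
move=> f_inj; have [m] := ubnP (size q); elim: m q => // m IHm q qm q0.
have [[n1 rootq]|noroot] := pselect (exists n, root q (f n)); last first.
  by exists 0%N => n _; apply/negP => qn; apply: noroot; exists n.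
have [q' qE] := factor_theorem _ _ rootq.
have q'0 : q' != 0 by apply: contraNneq q0 => q'0; rewrite qE q'0 mul0r.
have [|n0 n0P] := IHm q' _ q'0.
  by move: qm; rewrite qE size_Mmonic ?monicXsubC // size_XsubC addn2.
exists (maxn n0 n1.+1) => n; rewrite geq_max => /andP[n0n n1n].
rewrite qE hornerM mulf_neq0 ?n0P // !hornerE subr_eq0 (inj_eq f_inj).
by rewrite neq_ltn n1n orbT.
Qed.

End Regularity.

(** * Stabilization of the lattices *)

Section LocalLattices.
Variables (F : fieldType) (r : nat) (A : 'M[{fraction {poly F}}]_r).
Hypothesis uA : A \in unitmx.
Variable p : F.

(** This is (tau^-n L)_p, by [local_latticeE] below. *)
Definition local_lattice (n : int) : set 'cV[{fraction fps F}]_r :=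
  colspan frac_incl (map_mx (expand p) (Aiter A n)).

Lemma local_latticeE n :
  localize p (tauz A (- n) @` @std_lattice F r) = local_lattice n.
Proof. exact: localize_tauz. Qed.

Lemma expand_Aiter_unitmx n : map_mx (expand p) (Aiter A n) \in unitmx.
Proof. by rewrite map_unitmx Aiter_unitmx. Qed.

Lemma expand_Aiter_quotient n m :
  map_mx (expand p) (Aiter A n) *m
    map_mx (expand p) (invmx (Aiter A n) *m Aiter A m) =
  map_mx (expand p) (Aiter A m).
Proof. by rewrite map_mxM map_invmx (mulKVmx (expand_Aiter_unitmx n)). Qed.

Lemma local_lattice_basis n :
  is_basis frac_incl (map_mx (expand p) (Aiter A n)) (local_lattice n).
Proof.
apply: unitmx_is_basis (expand_Aiter_unitmx n) => x y /eqP.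
by rewrite tofrac_eq => /eqP.
Qed.

Lemma local_lattice_quotient n m :
  local_lattice m = mulmx (map_mx (expand p) (Aiter A n)) @`
    colspan frac_incl (map_mx (expand p) (invmx (Aiter A n) *m Aiter A m)).
Proof. by rewrite -colspan_mulmx expand_Aiter_quotient. Qed.

Lemma local_lattice_incr n :
  mx_defined_at (p + n%:~R) A -> local_lattice n `<=` local_lattice (n + 1).
Proof.
move=> /mx_defined_at_expand[C CE]; rewrite /local_lattice.
rewrite -[n in X in X `<=` _](addrK 1) AiterP // addrK map_mxM /= CE.
exact: colspan_sub.
Qed.

Lemma local_lattice_decr n :
  mx_defined_at (p + n%:~R) (invmx A) ->
  local_lattice (n + 1) `<=` local_lattice n.
Proof.
move=> /mx_defined_at_expand[C CE]; rewrite /local_lattice.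
rewrite AiterS // -map_invmx map_mxM /= CE.
exact: colspan_sub.
Qed.

(** The operator tau^-n turns multiplication by q(z) into multiplication by
    q(z + n), which is invertible in the local ring at p when q(p + n) is
    nonzero: locally the factor q disappears. *)
Lemma localize_tauz_sub (V W : set 'cV_r) (q : {poly F}) (n : int) :
    q.[p + n%:~R] != 0 -> (forall y, V y -> W (q%:F *: y)) ->
  localize p (tauz A (- n) @` V) `<=` localize p (tauz A (- n) @` W).
Proof.
move=> qn VW; have spanW := submod_span_submodule frac_incl
  (map_mx (expand p) @` (tauz A (- n) @` W)).
apply: (submod_span_sub spanW) => _ [_ [y Vy <-] <-].
set u := poly_taylor p (poly_shift n%:~R q).
have uU : u \is a GRing.unit by rewrite poly_taylor_unit horner_shift.
(* u is the expansion of q(z + n) at p. *)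
have -> : map_mx (expand p) (tauz A (- n) y) =
    u^-1%:F *: map_mx (expand p) (tauz A (- n) (q%:F *: y)).
  rewrite !tauzE // map_mxZ -scalemxAr map_mxZ /= shift_tofrac expand_tofrac.
  by rewrite -/u scalerA -tofracM mulVr // tofrac1 scale1r.
case: spanW => _ _; apply; apply: sub_submod_span.
by exists (tauz A (- n) (q%:F *: y)) => //; exists (q%:F *: y) => //; apply: VW.
Qed.

Lemma std_lattice_full : full_sublattice (diff_module A) (@std_lattice F r).
Proof.
split; first by exists r, 1%:M; exact: std_latticeE.
- exact: std_lattice_sub.
- by move=> y _; exact: std_lattice_torsion.
Qed.

(** V is finitely generated and contained in M, which is torsion modulo W. *)
Lemma full_sublattice_commensurable V W :
  full_sublattice (diff_module A) V -> full_sublattice (diff_module A) W ->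
  exists2 q : {poly F}, q != 0 & forall y, V y -> W (q%:F *: y).
Proof.
move=> [[k [B VE]] VM _] [[l [C WE]] _ WT]; rewrite VE.
apply: torsion_colspan; first by rewrite WE; exact: submod_span_submodule.
move=> j; apply: WT; apply: VM; rewrite VE; apply: sub_submod_span.
by exists j.
Qed.

Lemma full_sublattice_localize V W (t : nat -> int) :
    injective (fun n => (t n)%:~R : F) ->
    full_sublattice (diff_module A) V -> full_sublattice (diff_module A) W ->
  exists n0, forall n, (n0 <= n)%N ->
    localize p (tauz A (t n) @` V) `<=` localize p (tauz A (t n) @` W).
Proof.
move=> t_inj fV fW.
have [q q0 qVW] := full_sublattice_commensurable fV fW.
have [|n0 n0P] := @eventually_not_root _ (fun n => p + (- t n)%:~R) q _ q0.
  by move=> m n /addrI; rewrite !mulrNz => /oppr_inj/t_inj.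
exists n0 => n /n0P qn; rewrite -(opprK (t n)).
exact: localize_tauz_sub qn qVW.
Qed.

(** The set of which [xget] picks an element is the singleton of N: every
    admissible lattice is commensurable with L, hence yields the same limit,
    and L itself is admissible, which gives uniqueness. The choices of t
    that matter are t(n) = n and t(n) = -n, for [restr_left] and
    [restr_right]. *)
Lemma restr_stable (t : nat -> int) N :
    injective (fun n => (t n)%:~R : F) ->
    (exists n0, forall n, (n0 <= n)%N -> local_lattice (- t n) = N) ->
  xget set0 [set N | forall V, full_sublattice (diff_module A) V ->
    exists n0 : nat, forall n : nat, (n0 <= n)%N ->
      localize p (tauz A (t n) @` V) = N] = N.
Proof.
move=> t_inj [n0 n0P]; apply: xget_subset1 => [V fV|N1 N2 N1P N2P].
  have [n1 n1P] := full_sublattice_localize t_inj fV std_lattice_full.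
  have [n2 n2P] := full_sublattice_localize t_inj std_lattice_full fV.
  exists (maxn n0 (maxn n1 n2)) => n; rewrite !geq_max => /and3P[n0n n1n n2n].
  rewrite -(n0P n n0n) -local_latticeE opprK.
  by apply/seteqP; split; [exact: n1P|exact: n2P].
have [n1 n1P] := N1P _ std_lattice_full.
have [n2 n2P] := N2P _ std_lattice_full.
by rewrite -(n1P (maxn n1 n2)) ?n2P ?leq_maxl ?leq_maxr.
Qed.

(** M contains the standard basis vectors. *)
Lemma generic_fiber_diff_module : generic_fiber p (diff_module A) = setT.
Proof.
apply/seteqP; split=> // v _.
have : colspan idfun (1%:M : 'M[{fraction fps F}]_r) v.
  by rewrite colspan_unitmx ?unitmx1.
apply: submod_span_sub; first exact: submod_span_submodule.
move=> w w1; apply: sub_submod_span.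
apply: localizeS (@std_lattice_sub F r A) _ _.
rewrite std_latticeE localize_colspan map_mx1.
exact: sub_submod_span.
Qed.

Lemma local_lattice_bilattice_iso n m :
  bilattice_iso idfun
    (Bilattice setT (colspan frac_incl 1%:M)
      (colspan frac_incl
        (map_mx (expand p) (invmx (Aiter A n) *m Aiter A m))))
    (Bilattice (generic_fiber p (diff_module A))
      (local_lattice n) (local_lattice m)).
Proof.
rewrite generic_fiber_diff_module (local_lattice_quotient n m).
have -> : local_lattice n =
    mulmx (map_mx (expand p) (Aiter A n)) @` colspan frac_incl 1%:M.
  by rewrite -colspan_mulmx mulmx1.
exact: (mulmx_bilattice_iso _ _ (expand_Aiter_unitmx n)).
Qed.

Lemma localize_diff_module_sub (V : set 'cV_r) :
    is_submodule frac_incl V -> (forall n, local_lattice n `<=` V) ->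
  localize p (diff_module A) `<=` V.
Proof.
move=> subV latV.
apply: subset_trans (localizeS (diff_module_sub_span uA)) _.
rewrite localize_span; apply: submod_span_sub subV _.
move=> _ [y [n _ Ly] <-]; apply: (latV n); rewrite -local_latticeE.
by apply: sub_submod_span; exists y.
Qed.

Lemma local_lattice_sub n : local_lattice n `<=` localize p (diff_module A).
Proof.
rewrite -local_latticeE; apply: localizeS => _ [y Ly <-].
have My : diff_module A y by exact: std_lattice_sub.
have [_ Mtau Mtau_inv] : is_Delta_submodule A (diff_module A).
  split=> [|z Mz V VL|z Mz V VL]; last 2 first.
  - by case: (VL) => -[_ Vtau _] _; apply: Vtau; apply: Mz.
  - by case: (VL) => -[_ _ Vtau] _; apply: Vtau; apply: Mz.
  split=> [V [[[]]]//|u v Mu Mv V VL|a v Mv V VL]; case: (VL) => -[[_ VD VZ] _ _] _.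
    by apply: VD; [apply: Mu|apply: Mv].
  by apply: VZ; apply: Mv.
by case: (- n) => k; elim: k => [|k IHk] /=; auto.
Qed.

End LocalLattices.

(** * Singular points and the order of the coset *)

(** Applied with [Rel] equality, inclusion and reverse inclusion of sets. *)
Lemma int_chain (T : Type) (Rel : T -> T -> Prop) (f : int -> T) (a b : int) :
    (forall x, Rel x x) -> (forall x y z, Rel x y -> Rel y z -> Rel x z) ->
    (forall n, a <= n < b -> Rel (f n) (f (n + 1))) ->
  a <= b -> Rel (f a) (f b).
Proof.
move=> refl trans step ab; have -> : b = a + `|b - a|%N%:Z by lia.
have : (`|b - a| <= `|b - a|)%N by [].
elim: {1 3}`|b - a|%N => [|k IHk] kb; first by rewrite addr0.
apply: trans (IHk (ltnW kb)) _; rewrite -[k.+1]addn1 PoszD addrA.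
by apply: step; lia.
Qed.

Section SingularPoints.
Variables (F : numFieldType) (r : nat) (p : F) (B : 'M[{fraction {poly F}}]_r).
Variable m : int.

(** With B = A the hypothesis speaks of the poles of A. With B = A^-1 it speaks
    of the set Z_A, since [Z_set p A] unfolds to [P_set p (invmx A)].
    Characteristic zero makes n determined by p + n, so that the order on the
    coset is that of the integers. *)
Lemma mx_defined_below n :
    (forall q, P_set p B q -> Zle (p + m%:~R) q) ->
  n < m -> mx_defined_at (p + n%:~R) B.
Proof.
move=> Pm nm; apply: contrapT => /(conj (imageT (fun n => p + n%:~R) n)) /Pm.
case=> k; rewrite -addrA => /addrI; rewrite -[k%:R]/(k%:Z%:~R) -intrD.
by move=> /intr_inj nE; move: nm; rewrite nE gtrDl ltNge lez_nat leq0n.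
Qed.

Lemma mx_defined_above n :
    (forall q, P_set p B q -> Zlt q (p + m%:~R)) ->
  m <= n -> mx_defined_at (p + n%:~R) B.
Proof.
move=> Pm mn; apply: contrapT => /(conj (imageT (fun n => p + n%:~R) n)) /Pm.
case=> k; rewrite -addrA => /addrI; rewrite -[k.+1%:R]/(k.+1%:Z%:~R) -intrD.
by move=> /intr_inj mE; move: mn; rewrite mE gerDl leNgt ltz_nat.
Qed.

End SingularPoints.

(** * The two restrictions and the localization of the module *)

Section Restrictions.
Variables (F : numFieldType) (r : nat) (A : 'M[{fraction {poly F}}]_r).
Hypothesis uA : A \in unitmx.
Variable p : F.
Local Notation M := (diff_module A).
Local Notation lat := (local_lattice A p).

Lemma local_lattice_step n :
    mx_defined_at (p + n%:~R) A -> mx_defined_at (p + n%:~R) (invmx A) ->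
  lat n = lat (n + 1).
Proof.
by move=> defA defAi; apply/seteqP; split;
  [exact: local_lattice_incr|exact: local_lattice_decr].
Qed.

Lemma restr_leftE n1 :
    (forall q, (Z_set p A `|` P_set p A) q -> Zle (p + n1%:~R) q) ->
  restr_left A p M = lat n1.
Proof.
move=> below; apply: restr_stable => //.
  by move=> m n /intr_inj[].
exists `|n1|%N => n n1n; apply: (int_chain (Rel := eq)) => [//|||].
- by move=> ? ? ? -> ->.
- move=> k /andP[_ kn1]; apply: local_lattice_step.
    by apply: (mx_defined_below (m := n1)) => // q Pq; apply: below; right.
  by apply: (mx_defined_below (m := n1)) => // q Pq; apply: below; left.
- by lia.
Qed.

Lemma restr_rightE n2 :
    (forall q, (Z_set p A `|` P_set p A) q -> Zlt q (p + n2%:~R)) ->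
  restr_right A p M = lat n2.
Proof.
move=> above; apply: restr_stable => //.
  by move=> m n /intr_inj/oppr_inj[].
exists `|n2|%N => n n2n; rewrite opprK; apply/esym.
apply: (int_chain (Rel := eq)) => [//|||].
- by move=> ? ? ? -> ->.
- move=> k /andP[n2k _]; apply: local_lattice_step.
    by apply: (mx_defined_above (m := n2)) => // q Pq; apply: above; right.
  by apply: (mx_defined_above (m := n2)) => // q Pq; apply: above; left.
- by lia.
Qed.

(** Below n3 there are no poles of A and the lattices increase up to that of
    n3; from n4 on there are no poles of A^-1 and they decrease. *)
Lemma local_lattice_band n3 n4 n :
    n3 <= n4 ->
    (forall q, P_set p A q -> Zle (p + n3%:~R) q) ->
    (forall q, Z_set p A q -> Zlt q (p + n4%:~R)) ->
  exists2 k, n3 <= k <= n4 & lat n `<=` lat k.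
Proof.
move=> n34 Pn3 Zn4; have [nn3|n3n] := ltP n n3.
  exists n3; first by rewrite lexx.
  apply: (int_chain (Rel := fun V W => V `<=` W)); last exact: ltW.
  - exact: subset_refl.
  - by move=> ? ? ?; exact: subset_trans.
  - move=> k /andP[_ kn3]; apply: local_lattice_incr => //.
    exact: mx_defined_below kn3.
have [nn4|n4n] := leP n n4; first by exists n; rewrite ?n3n.
exists n4; first by rewrite n34 lexx.
apply: (int_chain (Rel := fun V W => W `<=` V)); last exact: ltW.
- exact: subset_refl.
- by move=> ? ? ? VW /subset_trans; apply.
- move=> k /andP[n4k _]; apply: local_lattice_decr => //.
  exact: mx_defined_above n4k.
Qed.

Lemma localize_diff_module_span n3 n4 (X : set 'cV[{fraction fps F}]_r) :
    n3 <= n4 ->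
    (forall q, P_set p A q -> Zle (p + n3%:~R) q) ->
    (forall q, Z_set p A q -> Zlt q (p + n4%:~R)) ->
    X `<=` localize p M ->
    (forall n, n3 <= n <= n4 -> lat n `<=` submod_span frac_incl X) ->
  localize p M = submod_span frac_incl X.
Proof.
move=> n34 Pn3 Zn4 XM latX; apply/seteqP; split.
  apply: localize_diff_module_sub => //; first exact: submod_span_submodule.
  move=> n; have [k kP] := local_lattice_band n n34 Pn3 Zn4.
  by move=> /subset_trans; apply; exact: latX.
apply: submod_span_sub XM; exact: submod_span_submodule.
Qed.

End Restrictions.

(** * The local type of a difference module *)

Theorem proposition4p6 (R : realType) (r : nat)
    (A : 'M[{fraction {poly R[i]}}]_r) (hA : A \in unitmx) (p : R[i]) :
  let L := @std_lattice R[i] r in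
  let M := diff_module A in
  let Ml := restr_left A p M in
  let Mr := restr_right A p M in
  let tauL (n : int) := tauz A n @` L in
  let PA := P_set p A in
  let ZA := Z_set p A in
  let expand_mx (B : 'M[{fraction {poly R[i]}}]_r) := map_mx (expand p) B in
  (forall n : int, tauL (- n) = colspan frac_incl (Aiter A n)) /\
  forall n1 n2 : int,
    (forall q, (ZA `|` PA) q -> Zle (p + n1%:~R) q) ->
    (forall q, (ZA `|` PA) q -> Zlt q (p + n2%:~R)) ->
    (* 1 *)
    (let C := expand_mx (invmx (Aiter A n1) *m Aiter A n2) in
     [/\ Ml = localize p (tauL (- n1)),
         Mr = localize p (tauL (- n2)),
         exists B : 'M[{fraction fps R[i]}]_r,
           is_basis frac_incl B Ml /\ is_basis frac_incl (B *m C) Mr,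
         forall k (B : 'M[{fraction fps R[i]}]_(r, k)),
           is_basis frac_incl B Ml -> is_basis idfun B (generic_fiber p M)
       & bilattice_iso idfun
           (Bilattice setT (colspan frac_incl 1%:M) (colspan frac_incl C))
           (restr_Ustar A p M)]) /\
    forall n3 n4 : int, n3 <= n4 ->
      (forall q, PA q -> Zle (p + n3%:~R) q) ->
      (forall q, ZA q -> Zlt q (p + n4%:~R)) ->
      (* 2 *)
      [/\ localize p M =
            submod_span frac_incl (\bigcup_(n in [set n : int | n3 <= n <= n4])
                           localize p (tauL (- n))),
          localize p M =
            submod_span frac_incl (\bigcup_(n in [set n : int | n3 <= n <= n4])
                           columns (expand_mx (Aiter A n))),
          Ml = localize p (tauL (- n1)) /\
          Ml = colspan frac_incl (expand_mx (Aiter A n1))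
        & Mr = localize p (tauL (- n2)) /\
          Mr = colspan frac_incl (expand_mx (Aiter A n2))] /\
      (* 3 *)
      (n3 = n4 ->
       localize p M = localize p (tauL (- n3)) /\
       exists B : 'M[{fraction fps R[i]}]_r,
         [/\ is_basis frac_incl B (localize p M),
             Ml = mulmx B @`
               colspan frac_incl (expand_mx (invmx (Aiter A n3) *m Aiter A n1))
           & Mr = mulmx B @`
               colspan frac_incl (expand_mx (invmx (Aiter A n3) *m Aiter A n2))]).
Proof.
move=> L M Ml Mr tauL PA ZA expand_mx.
split=> [n|n1 n2 below above]; first exact: tauz_std_lattice.
have tauLE n : localize p (tauL (- n)) = local_lattice A p n.
  exact: local_latticeE.
have MlE : Ml = local_lattice A p n1 by exact: restr_leftE.
have MrE : Mr = local_lattice A p n2 by exact: restr_rightE.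
split.
  move=> C; split; rewrite ?tauLE //.
  - exists (expand_mx (Aiter A n1)); rewrite MlE MrE expand_Aiter_quotient //.
    by split; exact: local_lattice_basis.
  - move=> k B; rewrite MlE generic_fiber_diff_module.
    exact: frac_basis_generic (expand_Aiter_unitmx hA p n1).
  - rewrite /restr_Ustar -/Ml -/Mr MlE MrE.
    exact: local_lattice_bilattice_iso.
move=> n3 n4 n34 Pn3 Zn4.
have bigspan : localize p M =
    submod_span frac_incl (\bigcup_(n in [set n : int | n3 <= n <= n4])
      localize p (tauL (- n))).
  apply: (localize_diff_module_span _ n34 Pn3 Zn4) => // [v [n _]|n n34n v].
    by rewrite tauLE; exact: local_lattice_sub.
  by move=> nv; apply: sub_submod_span; exists n; rewrite ?tauLE.
split.
  split=> //; first last.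
  - by rewrite tauLE.
  - by rewrite tauLE.
  apply: (localize_diff_module_span _ n34 Pn3 Zn4) => // [v [n _] vn|n n34n].
    by apply: local_lattice_sub => //; apply: sub_submod_span; exact: vn.
  apply: submod_span_sub; first exact: submod_span_submodule.
  by move=> v vn; apply: sub_submod_span; exists n.
move=> n3E; have M3 : localize p M = local_lattice A p n3.
  rewrite bigspan -n3E; apply/seteqP; split.
    apply: submod_span_sub; first exact: submod_span_submodule.
    move=> v [n /= n33]; have -> : n = n3 by apply/le_anti; rewrite andbC.
    by rewrite tauLE.
  move=> v v3; apply: sub_submod_span; exists n3; rewrite /= ?lexx //.
  by rewrite tauLE.
rewrite tauLE; split=> //; exists (expand_mx (Aiter A n3)); split.
- by rewrite M3; exact: local_lattice_basis.
- by rewrite MlE; exact: local_lattice_quotient.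
- by rewrite MrE; exact: local_lattice_quotient.
Qed.
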